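(* Let $\varphi_1,\varphi_2\in L^{1}(\Omega,\nu)$. Let $[u_{1},v_1]$ be a subsolution of $(GP_{\varphi_1})$ and let $[u_{2},v_2]$ be a supersolution of $(GP_{\varphi_2})$. Then $$\int_\Omega (v_1-v_2)^+\,d\nu \le \int_\Omega (\varphi_1-\varphi_2)^+\,d\nu .$$ Moreover, if $\varphi_1\le \varphi_2$ with $\varphi_1\neq\varphi_2$ (as elements of $L^1(\Omega,\nu)$), then $v_1\le v_2$, $v_1\neq v_2$, and $u_1\le u_2$ $\nu$-a.e. in $\Omega$. Furthermore, if $\varphi_1=\varphi_2$ and $[u_i,v_i]$ is a solution of $(GP_{\varphi_i})$ for $i=1,2$, then $v_1=v_2$ $\nu$-a.e. in $\Omega$ and $u_1-u_2$ is $\nu$-a.e. equal to a constant.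
   Context: **Metric random walk space.** $(X,d)$ is a Polish metric space with its Borel $\sigma$-algebra (all sets and measures refer to it). A random walk $m=(m_x)_{x\in X}$ on $X$ is a family of Borel probability measures $m_x$ on $X$ depending measurably on $x$ (for every Borel $A\subset X$, $x\mapsto m_x(A)$ is Borel) and each with finite first moment ($\int_X d(z,y)\,dm_x(y)<+\infty$ for some, hence any, $z\in X$). $[X,d,m]$ is called a metric random walk space. $\nu$ is a $\sigma$-finite measure on $X$ that is reversible with respect to $m$: for every Borel $C\subset X\times X$, $\int_X\int_X \chi_C(x,y)\,dm_x(y)\,d\nu(x)=\int_X\int_X \chi_C(x,y)\,dm_y(x)\,d\nu(y)$. The measure $\nu\otimes m_x$ on $X\times X$ is defined by $(\nu\otimes m_x)(C)=\int_X\int_X\chi_C(x,y)\,dm_x(y)\,d\nu(x)$. A measurable set $\Omega\subset X$ with $\nu(\Omega)>0$ is $m$-connected if $\int_A m_x(B)\,d\nu(x)>0$ for all measurable non-$\nu$-null $A,B\subset\Omega$ with $A\cup B=\Omega$. **The function $\mathbf a_p$.** $1<p<+\infty$, $p'=p/(p-1)$, and $\mathbf a_p:X\times X\times\mathbb R\to\mathbb R$ satisfies: $(x,y)\mapsto \mathbf a_p(x,y,r)$ is measurable for every $r\in\mathbb R$; for $\nu\otimes m_x$-a.e. $(x,y)$, $\mathbf a_p(x,y,\cdot)$ is continuous; and for $\nu\otimes m_x$-a.e. $(x,y)$ one has $\mathbf a_p(x,y,r)=-\mathbf a_p(y,x,-r)$ for every $r$, $(\mathbf a_p(x,y,r)-\mathbf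 a_p(x,y,s))(r-s)>0$ for every $r\ne s$, $|\mathbf a_p(x,y,r)|\le C_p(1+|r|^{p-1})$ and $\mathbf a_p(x,y,r)r\ge c_p|r|^p$ for every $r$, where $c_p,C_p>0$ are constants. **Domain and graphs.** $\Omega_1,\Omega_2\subset X$ are disjoint measurable non-$\nu$-null sets, $\Omega:=\Omega_1\cup\Omega_2$ is $m$-connected and $\nu(\Omega)<+\infty$. It is assumed that $\nu(\{x\in\Omega: m_x|_\Omega\perp\nu|_\Omega\})=0$, where $\perp$ denotes mutual singularity of the restrictions to $\Omega$. $\gamma,\beta$ are maximal monotone (multivalued) graphs in $\mathbb R\times\mathbb R$ with $0\in\gamma(0)\cap\beta(0)$ and $\mathcal R^-_{\gamma,\beta}<\mathcal R^+_{\gamma,\beta}$, where $\mathcal R^-_{\gamma,\beta}:=\nu(\Omega_1)\inf\mathrm{Ran}(\gamma)+\nu(\Omega_2)\inf\mathrm{Ran}(\beta)$ and $\mathcal R^+_{\gamma,\beta}:=\nu(\Omega_1)\sup\mathrm{Ran}(\gamma)+\nu(\Omega_2)\sup\mathrm{Ran}(\beta)$ (possibly infinite). **Poincaré type assumption.** For every $0<l\le\nu(\Omega)$ there is $\Lambda>0$ such that for every $u\in L^p(\Omega,\nu)$ and every measurable $Z\subset\Omega$ with $\nu(Z)\ge l$: $\|u\|_{L^p(\Omega,\nu)}\le\Lambda\big((\int_{\Omega\times\Omega}|u(y)-u(x)|^p\,dm_x(y)\,d\nu(x))^{1/p}+|\int_Z u\,d\nu|\big)$. **Problem $(GP_\varphi)$.**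 Given $\varphi\in L^1(\Omega,\nu)$, $(GP_\varphi)$ is the problem $\gamma(u(x))-\int_\Omega\mathbf a_p(x,y,u(y)-u(x))\,dm_x(y)\ni\varphi(x)$ for $x\in\Omega_1$, $\beta(u(x))-\int_\Omega\mathbf a_p(x,y,u(y)-u(x))\,dm_x(y)\ni\varphi(x)$ for $x\in\Omega_2$. A solution is a pair $[u,v]$ with $u\in L^p(\Omega,\nu)$, $v\in L^{p'}(\Omega,\nu)$ such that 1. $v(x)\in\gamma(u(x))$ for $\nu$-a.e. $x\in\Omega_1$; 2. $v(x)\in\beta(u(x))$ for $\nu$-a.e. $x\in\Omega_2$; 3. $(x,y)\mapsto\mathbf a_p(x,y,u(y)-u(x))$ belongs to $L^{p'}(\Omega\times\Omega,\nu\otimes m_x)$; 4. $v(x)-\int_\Omega\mathbf a_p(x,y,u(y)-u(x))\,dm_x(y)=\varphi(x)$ for ($\nu$-a.e.) $x\in\Omega$. A subsolution (respectively supersolution) of $(GP_\varphi)$ is a pair $[u,v]$ with $u\in L^p(\Omega,\nu)$, $v\in L^1(\Omega,\nu)$ satisfying 1, 2, 3 and 4 with ''$=$'' replaced by ''$\le$'' (respectively ''$\ge$''). *)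

(* Defs.v *)
From HB Require Import structures.
From mathcomp Require Import all_boot all_order all_algebra.
From mathcomp Require Import all_classical all_reals all_analysis.

Set Implicit Arguments.
Unset Strict Implicit.
Unset Printing Implicit Defensive.

Import Order.TTheory GRing.Theory Num.Theory.
Import numFieldNormedType.Exports.

Local Open Scope classical_set_scope.
Local Open Scope ring_scope.
Local Open Scope ereal_scope.

#[short(type="completeMetricType")]
HB.structure Definition CompleteMetric (K : numDomainType) :=
  {T of Metric K T & Complete T}.

Definition separable (T : topologicalType) :=
  exists2 D : set T, countable D & dense D.

(* A Polish metric space is a separable [X : completeMetricType R]; as its
   topology is second countable, the product sigma-algebra on
   [borel X * borel X] is the Borel sigma-algebra of [X * X]. *)
Notation borel X := (g_sigma_algebraType (@open X)).

Section kernel_measure.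
Context d (T : measurableType d) (R : realType).
Variables (nu : {measure set T -> \bar R}) (m : R.-pker T ~> T).

Definition nu_kernel (C : set (T * T)) : \bar R :=
  \int[nu]_x \int[m x]_y (\1_C (x, y))%:E.

Let nu_kernelE C : measurable C ->
  nu_kernel C = \int[nu]_x m x (xsection C x).
Proof.
move=> mC; apply: eq_integral => x _.
rewrite -[in RHS](setIT (xsection C x)) -integral_indic//; last first.
  exact: measurable_xsection.
by apply: eq_integral => y _; rewrite !indicE mem_xsection.
Qed.

Let nu_kernel0 : nu_kernel set0 = 0.
Proof.
rewrite nu_kernelE//; apply: integral0_eq => x _.
by rewrite xsection0 measure0.
Qed.

Let nu_kernel_ge0 C : 0 <= nu_kernel C.
Proof.
by apply: integral_ge0 => x _; apply: integral_ge0 => y _; rewrite lee_fin.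
Qed.

Let nu_kernel_semi_sigma_additive : semi_sigma_additive nu_kernel.
Proof.
move=> F mF tF mUF; rewrite nu_kernelE//.
rewrite [X in X @ \oo --> _](_ : _ = fun n =>
    \sum_(0 <= i < n) \int[nu]_x m x (xsection (F i) x)); last first.
  by apply/funext => n; apply: eq_bigr => i _; exact: nu_kernelE.
rewrite [X in _ --> X](_ : _ =
    \sum_(i <oo) \int[nu]_x m x (xsection (F i) x)).
  by apply: is_cvg_nneseries => n _ _; exact: integral_ge0.
rewrite -integral_nneseries//; last first.
  by move=> n; apply: measurable_fun_xsection_finite_kernel; rewrite inE.
apply: eq_integral => x _; rewrite xsection_bigcup.
apply/esym/cvg_lim => //; apply: measure_semi_sigma_additive.
- by move=> n; exact: measurable_xsection.
- exact: trivIset_xsection.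
- by apply: bigcup_measurable => n _; exact: measurable_xsection.
Qed.

HB.instance Definition _ := isMeasure.Build _ _ _ nu_kernel
  nu_kernel0 nu_kernel_ge0 nu_kernel_semi_sigma_additive.

End kernel_measure.

Section random_walk.
Context d (T : measurableType d) (R : realType).
Variables (nu : {measure set T -> \bar R}) (m : R.-pker T ~> T).

Definition reversible := forall C : set (T * T), measurable C ->
  \int[nu]_x \int[m x]_y (\1_C (x, y))%:E =
  \int[nu]_y \int[m y]_x (\1_C (x, y))%:E.

Definition m_connected (Om : set T) := [/\ measurable Om, 0 < nu Om &
  forall A B : set T, measurable A -> measurable B ->
    A `<=` Om -> B `<=` Om -> nu A != 0 -> nu B != 0 -> A `|` B = Om ->
    0 < \int[nu]_(x in A) m x B].

Definition singular_on (Om : set T) (mu1 mu2 : {measure set T -> \bar R}) :=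
  exists A : set T, [/\ measurable A, mu1 (A `&` Om) = 0 &
    mu2 (~` A `&` Om) = 0].

(* A function on [D] is represented by a function on the whole space,
   extended by zero outside [D]. *)
Definition inLp d' (T' : measurableType d') (mu : {measure set T' -> \bar R})
    (D : set T') (q : R) (f : T' -> R) :=
  f \_ D \in Lfun mu q%:E.

(* Membership in L^q of an almost everywhere class: unlike [inLp], it does not
   require [f] itself to be measurable. It is used for
   (x, y) |-> a x y (u y - u x), which may fail to be Borel on a null set
   because [a x y] is continuous for almost every (x, y) only. *)
Definition inLp_ae d' (T' : measurableType d')
    (mu : {measure set T' -> \bar R}) (D : set T') (q : R) (f : T' -> R) :=
  exists2 g : T' -> R, inLp mu D q g & f = g %[ae mu in D].

Definition poincare (p : R) (Om : set T) :=
  forall l : R, (0 < l)%R -> l%:E <= nu Om ->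
  exists2 Lambda : R, (0 < Lambda)%R &
  forall (u : T -> R) (Z : set T), inLp nu Om p u ->
    measurable Z -> Z `<=` Om -> l%:E <= nu Z ->
    'N[nu]_p%:E [EFin \o (u \_ Om)] <= Lambda%:E *
      ((\int[nu]_(x in Om) \int[m x]_(y in Om) (`|u y - u x| `^ p)%:E) `^ p^-1
       + `| \int[nu]_(x in Z) (u x)%:E |).

Record leray_lions (p cp Cp : R) (a : T -> T -> R -> R) : Prop := LerayLions {
  ll_measurable : forall r : R,
    measurable_fun [set: T * T] (fun z => a z.1 z.2 r) ;
  ll_continuous : \forall z \ae nu_kernel nu m, continuous (a z.1 z.2) ;
  ll_antisym : \forall z \ae nu_kernel nu m,
    forall r : R, a z.1 z.2 r = (- a z.2 z.1 (- r))%R ;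
  ll_monotone : \forall z \ae nu_kernel nu m, forall r s : R, r != s ->
    (0 < (a z.1 z.2 r - a z.1 z.2 s) * (r - s))%R ;
  ll_growth : \forall z \ae nu_kernel nu m, forall r : R,
    (`|a z.1 z.2 r| <= Cp * (1 + `|r| `^ (p - 1)))%R ;
  ll_coercive : \forall z \ae nu_kernel nu m, forall r : R,
    (cp * `|r| `^ p <= a z.1 z.2 r * r)%R
}.

End random_walk.

(* The first moment of [m x] is finite about some, equivalently any, point. *)
Definition finite_first_moments (R : realType) (X : completeMetricType R)
    (m : R.-pker borel X ~> borel X) :=
  forall x : X, exists z : X, \int[m x]_y (mdist z (y : X))%:E < +oo.

(* A multivalued graph in R x R is a function [g : R -> set R]; [g r v] means
   that (r, v) belongs to the graph, and [g r] may be empty. *)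
Section graphs.
Variable R : realType.
Implicit Type g : R -> set R.

Definition monotone_graph g := forall r s v w : R, g r v -> g s w ->
  (0 <= (v - w) * (r - s))%R.

Definition maximal_monotone g := monotone_graph g /\
  forall h : R -> set R, monotone_graph h ->
    (forall r, g r `<=` h r) -> forall r, h r `<=` g r.

Definition Ran g : set R := [set v | exists r, g r v].

Context d (T : measurableType d) (nu : {measure set T -> \bar R}).

Definition Rminus (Om1 Om2 : set T) gamma beta : \bar R :=
  nu Om1 * ereal_inf (EFin @` Ran gamma) +
  nu Om2 * ereal_inf (EFin @` Ran beta).

Definition Rplus (Om1 Om2 : set T) gamma beta : \bar R :=
  nu Om1 * ereal_sup (EFin @` Ran gamma) +
  nu Om2 * ereal_sup (EFin @` Ran beta).

End graphs.

Section GP.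
Context d (T : measurableType d) (R : realType).
Variables (nu : {measure set T -> \bar R}) (m : R.-pker T ~> T).
Variables (p : R) (a : T -> T -> R -> R).
Variables (Om1 Om2 : set T) (gamma beta : R -> set R).
Implicit Types (phi u v : T -> R).

Let Om := Om1 `|` Om2.
Let p' : R := (p / (p - 1))%R.

Definition GP_constraints u v :=
  [/\ \forall x \ae nu, Om1 x -> gamma (u x) (v x),
      \forall x \ae nu, Om2 x -> beta (u x) (v x) &
      inLp_ae (nu_kernel nu m) (Om `*` Om) p'
        (fun z => a z.1 z.2 (u z.2 - u z.1)%R)].

Definition GP_lhs u v (x : T) : \bar R :=
  (v x)%:E - \int[m x]_(y in Om) (a x y (u y - u x)%R)%:E.

Definition GP_solution phi u v :=
  [/\ inLp nu Om p u, inLp nu Om p' v, GP_constraints u v &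
      \forall x \ae nu, Om x -> GP_lhs u v x = (phi x)%:E].

Definition GP_subsolution phi u v :=
  [/\ inLp nu Om p u, inLp nu Om 1 v, GP_constraints u v &
      \forall x \ae nu, Om x -> GP_lhs u v x <= (phi x)%:E].

Definition GP_supersolution phi u v :=
  [/\ inLp nu Om p u, inLp nu Om 1 v, GP_constraints u v &
      \forall x \ae nu, Om x -> GP_lhs u v x >= (phi x)%:E].

End GP.

(* Main.v *)
Require Import Defs.
From HB Require Import structures.
From mathcomp Require Import all_boot all_order all_algebra.
From mathcomp Require Import all_classical all_reals all_analysis.
From mathcomp Require Import measure_function measurable_realfun.
From mathcomp Require Import lra.

Set Implicit Arguments.
Unset Strict Implicit.
Unset Printing Implicit Defensive.

Import Order.TTheory GRing.Theory Num.Theory.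
Import numFieldNormedType.Exports.

Local Open Scope classical_set_scope.
Local Open Scope ring_scope.
Local Open Scope ereal_scope.

(** Let [Om = Om1 `|` Om2], let [A_i (x, y) = a x y (u_i y - u_i x)] be the
    flux of [u_i], and let [h = A_1 - A_2] on [Om * Om], extended by zero.
    Subtracting the two inequalities gives, for almost every [x] in [Om],
    [v1 x - v2 x <= phi1 x - phi2 x + \int[m x]_y h (x, y)].
    Reversibility and the antisymmetry of [a] make [h] antisymmetric under the
    exchange of [x] and [y], which preserves the measure [nu_kernel nu m].
    Integrating over a measurable [E `<=` Om], the part of [h] that lives on
    [E * E] cancels and only the flux through the boundary of [E] is left:
    [\int_E (v1 - v2) <= \int_E (phi1 - phi2) + \int_(E * ~E) h]
    ([sub_super_balance]).

    If [u1 - u2] is at least as large on [E] as on the rest of [Om], then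
    monotonicity of [a] gives [h <= 0] on [E * ~E], and the last term can be
    dropped ([integral_v_le_phi]). The contraction in [L^1] is this inequality
    for the set where [u1 > u2], or [u1 = u2] and [v1 > v2]: by monotonicity of
    the graphs, [v1 - v2] agrees on this set with its positive part, which
    vanishes on the rest of [Om]. Testing with this indicator function itself,
    instead of approximating it by Lipschitz truncations of [u1 - u2], makes
    every integral well defined as soon as the fluxes are integrable.

    For a strict superlevel set [E] of [u1 - u2], strict monotonicity gives
    [h < 0] on [E * (Om \ E)]. If moreover [\int_E (phi1 - phi2)] is at most
    [\int_E (v1 - v2)], then the boundary term is nonnegative, so that
    [E * (Om \ E)] is null and, [Om] being m-connected, [E] is null or has full
    measure in [Om] ([superlevel_dichotomy]). For [phi1 <= phi2] this is applied
    to the level [0]: [u1 > u2] almost everywhere would force [v1 = v2], which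
    is excluded by the balance on [E = Om]. For two solutions with the same
    datum it applies to every level, and a function all of whose superlevel
    sets are null or of full measure is constant. *)

(** * Integrals of almost everywhere equal functions *)

Section nonmeasurable_integral.
Context d (T : measurableType d) (R : realType) (mu : {measure set T -> \bar R}).
Import HBNNSimple.

(** The integral of a nonnegative function is a supremum over the measurable
    simple functions below it, and those can be cut off on a measurable null
    set without changing their integral. The functions of interest are the
    [y |-> a x y (u y - u x)], which agree only almost everywhere with a
    measurable function. *)
Lemma ge0_ae_le_integral_nonmeasurable (f g : T -> \bar R) :
  (forall x, 0 <= f x) -> (forall x, 0 <= g x) ->
  (\forall x \ae mu, f x <= g x) ->
  \int[mu]_x f x <= \int[mu]_x g x.
Proof.
move=> f0 g0 [Z [mZ Z0 fgZ]].
rewrite ge0_integralTE//; apply: ge_ereal_sup => _ [h hf <-].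
pose k := mul_nnsfun h (indic_nnsfun R (measurableC mZ)).
have -> : sintegral mu h = sintegral mu k.
  rewrite -!integralT_nnsfun; apply: ge0_ae_eq_integral => //.
  - exact/measurable_EFinP.
  - exact/measurable_EFinP.
  - by move=> x _; rewrite lee_fin.
  - by move=> x _; rewrite lee_fin.
  exists Z; split => // x /= /not_implyP[_ hk]; apply: contrapT => Zx.
  by apply: hk; rewrite /= mindicE mem_set// mulr1.
rewrite [leRHS]ge0_integralTE//; apply: ereal_sup_ubound; exists k => //= x.
rewrite /= mindicE; have [xZ|xZ] := boolP (x \in ~` Z).
  rewrite mulr1 (le_trans (hf x))//; apply: contrapT => fg.
  by move/set_mem : xZ; apply; exact: fgZ.
by rewrite mulr0.
Qed.

Lemma ae_eq_integral_nonmeasurable (D : set T) (f g : T -> \bar R) :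
  (\forall x \ae mu, D x -> f x = g x) ->
  \int[mu]_(x in D) f x = \int[mu]_(x in D) g x.
Proof.
move=> fg; rewrite integral_mkcond [RHS]integral_mkcond.
have {}fg : \forall x \ae mu, (f \_ D) x = (g \_ D) x.
  apply: filterS fg => x fg; rewrite !patchE.
  by case: ifPn => // /set_mem /fg.
rewrite integralE [RHS]integralE; congr (_ - _); apply/eqP; rewrite eq_le;
  apply/andP; split; apply: ge0_ae_le_integral_nonmeasurable => //;
  by apply: filterS fg => x; rewrite !(funeposE, funenegE) => ->.
Qed.

End nonmeasurable_integral.

(** * Integration against the measure [nu_kernel nu m] *)

Section nu_kernel_integral.
Context d (T : measurableType d) (R : realType).
Variables (nu : {measure set T -> \bar R}) (m : R.-pker T ~> T).
Import HBNNSimple.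

Let integral_nu_kernel_nnsfun (f : {nnsfun (T * T)%type >-> R}) :
  \int[nu_kernel nu m]_z (f z)%:E = \int[nu]_x \int[m x]_y (f (x, y))%:E.
Proof.
pose F (r : R) x := \int[m x]_y (r * \1_(f @^-1` [set r]) (x, y))%:E.
have F0 r x : 0 <= F r x.
  by apply: integral_ge0 => y _; rewrite EFinM nnfun_muleindic_ge0.
have mF r : measurable_fun setT (F r).
  apply: (measurable_fun_integral_finite_kernel
    (fun z => (r * \1_(f @^-1` [set r]) z)%:E) m).
    by move=> z; rewrite EFinM nnfun_muleindic_ge0.
  exact/measurable_EFinP/measurableT_comp.
under [in LHS]eq_integral do rewrite fimfunE -fsumEFin//.
rewrite ge0_integral_fsum//; last 2 first.
  - by move=> r; exact/measurable_EFinP/measurableT_comp.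
  - by move=> r z _; rewrite EFinM nnfun_muleindic_ge0.
transitivity (\int[nu]_x \sum_(r \in range f) F r x); last first.
  apply: eq_integral => x _; rewrite /F.
  under [in RHS]eq_integral do rewrite fimfunE -fsumEFin//.
  rewrite ge0_integral_fsum//.
  - move=> r; apply/measurable_EFinP/measurableT_comp => //.
    exact: (measurableT_comp _ (pair1_measurable x)).
  - by move=> r y _; rewrite EFinM nnfun_muleindic_ge0.
rewrite ge0_integral_fsum//.
apply: eq_fsbigr => r _; have [r0|r0] := leP 0%R r; last first.
  have f0 : f @^-1` [set r] = set0 by exact: preimage_nnfun0.
  rewrite integral0_eq; last by move=> z _; rewrite f0 indic0 mulr0.
  rewrite integral0_eq// => x _; rewrite /F integral0_eq// => y _.
  by rewrite f0 indic0 mulr0.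
under eq_integral do rewrite EFinM.
rewrite ge0_integralZl//; last exact/measurable_EFinP.
rewrite integral_indic// setIT.
transitivity (\int[nu]_x (r%:E * \int[m x]_y (\1_(f @^-1` [set r]) (x, y))%:E)).
  rewrite ge0_integralZl//.
  - apply: (measurable_fun_integral_finite_kernel
      (fun z => (\1_(f @^-1` [set r]) z)%:E) m) => //.
    exact/measurable_EFinP.
  - by move=> x _; exact: integral_ge0.
apply: eq_integral => x _; rewrite /F.
under [RHS]eq_integral do rewrite EFinM.
rewrite ge0_integralZl//; apply/measurable_EFinP.
exact: (measurableT_comp _ (pair1_measurable x)).
Qed.

(** Tonelli's theorem: it holds for indicators by definition of [nu_kernel],
    for simple functions by linearity, and passes to increasing limits. *)
Lemma ge0_integral_nu_kernel (f : T * T -> \bar R) :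
  (forall z, 0 <= f z) -> measurable_fun setT f ->
  \int[nu_kernel nu m]_z f z = \int[nu]_x \int[m x]_y f (x, y).
Proof.
move=> f0 mf; pose f_ := nnsfun_approx measurableT mf.
have f_E z : f z = limn (fun n => (f_ n z)%:E).
  by apply/esym/cvg_lim => //; exact: cvg_nnsfun_approx.
have nd_f z : nondecreasing_seq (fun n => (f_ n z)%:E).
  by move=> a b ab; rewrite lee_fin; exact/lefP/nd_nnsfun_approx.
rewrite (eq_integral (fun z => limn (fun n => (f_ n z)%:E)))//.
have mfx n x : measurable_fun setT (fun y => (f_ n (x, y))%:E).
  by apply/measurable_EFinP; exact: (measurableT_comp _ (pair1_measurable x)).
rewrite monotone_convergence//; last 2 first.
- by move=> n; exact/measurable_EFinP.
- by move=> n z _; rewrite lee_fin.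
transitivity (\int[nu]_x limn (fun n => \int[m x]_y (f_ n (x, y))%:E)).
  rewrite monotone_convergence//.
  - by under eq_fun do rewrite integral_nu_kernel_nnsfun.
  - move=> n; apply: (measurable_fun_integral_finite_kernel
      (fun z => (f_ n z)%:E) m); first by move=> z; rewrite lee_fin.
    exact/measurable_EFinP.
  - by move=> n x _; apply: integral_ge0 => y _; rewrite lee_fin.
  - move=> x _ a b ab; apply: ge0_le_integral => //.
    + by move=> y _; rewrite lee_fin.
    + by move=> y _; exact: nd_f.
apply: eq_integral => x _; rewrite -monotone_convergence//.
- by apply: eq_integral => y _; rewrite f_E.
- by move=> n y _; rewrite lee_fin.
Qed.

Lemma ae_nu_kernel (P : T * T -> Prop) :
  (\forall z \ae nu_kernel nu m, P z) ->
  \forall x \ae nu, \forall y \ae m x, P (x, y).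
Proof.
move=> [Z [mZ Z0 PZ]].
have mh : measurable_fun setT (fun x => m x (xsection Z x)).
  by apply: measurable_fun_xsection_finite_kernel; rewrite inE.
have : \int[nu]_x `|m x (xsection Z x)| = 0.
  rewrite -[RHS]Z0 -[in RHS](setIT Z) -integral_indic// ge0_integral_nu_kernel//.
  - apply: eq_integral => x _; rewrite gee0_abs//.
    rewrite -[in LHS](setIT (xsection Z x)) -integral_indic//; last first.
      exact: measurable_xsection.
    by apply: eq_integral => y _; rewrite !indicE mem_xsection.
  - exact/measurable_EFinP.
move/(ae_eq_integral_abs nu measurableT mh).
apply: filterS => x /(_ I) /= mx0; exists (xsection Z x); split => //.
  exact: measurable_xsection.
by move=> y /= nP; rewrite /xsection/= inE; exact: PZ.
Qed.

End nu_kernel_integral.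

Section divergence.
Context d (T : measurableType d) (R : realType).
Variables (nu : {measure set T -> \bar R}) (m : R.-pker T ~> T).

Lemma ge0_integral_nu_kernel_strip (E : set T) (f : T * T -> \bar R) :
  measurable E -> (forall z, 0 <= f z) -> measurable_fun setT f ->
  \int[nu_kernel nu m]_(z in E `*` setT) f z =
  \int[nu]_(x in E) \int[m x]_y f (x, y).
Proof.
move=> mE f0 mf; rewrite [LHS]integral_mkcond ge0_integral_nu_kernel; last 2 first.
- by move=> z; rewrite patchE; case: ifPn.
- apply/(measurable_restrictT _ _).1; first exact: measurableX.
  exact: measurable_funTS.
rewrite [RHS]integral_mkcond; apply: eq_integral => x _.
rewrite [RHS]patchE; case: ifPn => xE.
  by apply: eq_integral => y _; rewrite patchE in_setX xE in_setT.
by apply: integral0_eq => y _; rewrite patchE in_setX (negbTE xE).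
Qed.

Lemma nu_kernelX (A B : set T) : measurable A -> measurable B ->
  nu_kernel nu m (A `*` B) = \int[nu]_(x in A) m x B.
Proof.
move=> mA mB; rewrite /nu_kernel [RHS]integral_mkcond.
apply: eq_integral => x _; rewrite patchE; case: ifPn => xA.
  rewrite -[in RHS](setIT B) -integral_indic//.
  by apply: eq_integral => y _; rewrite !indicE in_setX xA.
by apply: integral0_eq => y _; rewrite indicE in_setX (negbTE xA).
Qed.

(** Fubini's theorem for an integrable [f]: the divergence
    [x |-> \int[m x]_y f (x, y)] is defined almost everywhere and integrable. *)
Variable f : T * T -> \bar R.
Hypothesis intf : (nu_kernel nu m).-integrable setT f.

Let mf : measurable_fun setT f. Proof. exact: measurable_int intf. Qed.

Let integrable_section (g : T * T -> \bar R) : (forall z, 0 <= g z) ->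
  (nu_kernel nu m).-integrable setT g ->
  nu.-integrable setT (fun x => \int[m x]_y g (x, y)).
Proof.
move=> g0 /integrableP[mg ig].
have Ig0 x : 0 <= \int[m x]_y g (x, y) by exact: integral_ge0.
apply/integrableP; split.
  exact: (measurable_fun_integral_finite_kernel g m).
under eq_integral do rewrite gee0_abs//.
rewrite -ge0_integral_nu_kernel//.
by under eq_integral do rewrite -[g _]gee0_abs//.
Qed.

Lemma ae_integrable_section :
  \forall x \ae nu, (m x).-integrable setT (fun y => f (x, y)).
Proof.
have := integrable_ae measurableT
  (integrable_section (fun z => abse_ge0 (f z)) (integrable_abse intf)).
apply: filterS => x /(_ I) fx; apply/integrableP; split.
  exact: (measurableT_comp mf (pair1_measurable x)).
by rewrite -ge0_fin_numE//; exact: integral_ge0.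
Qed.

Let integral_sectionE x : \int[m x]_y f (x, y) =
  \int[m x]_y f^\+ (x, y) - \int[m x]_y f^\- (x, y).
Proof.
rewrite integralE; congr (_ - _); apply: eq_integral => y _.
- by rewrite !funeposE.
- by rewrite !funenegE.
Qed.

Lemma integrable_divergence :
  nu.-integrable setT (fun x => \int[m x]_y f (x, y)).
Proof.
under eq_fun do rewrite integral_sectionE.
apply: integrableB => //; apply: integrable_section => //.
- exact: integrable_funepos.
- exact: integrable_funeneg.
Qed.

Lemma integral_divergence (E : set T) : measurable E ->
  \int[nu]_(x in E) \int[m x]_y f (x, y) =
  \int[nu_kernel nu m]_(z in E `*` setT) f z.
Proof.
move=> mE; under eq_integral do rewrite integral_sectionE.
rewrite integralB//; last 2 first.
- apply: integrableS (integrable_section _ _) => //.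
  exact: integrable_funepos.
- apply: integrableS (integrable_section _ _) => //.
  exact: integrable_funeneg.
rewrite [RHS]integralE; congr (_ - _).
- rewrite ge0_integral_nu_kernel_strip//; exact: measurable_funepos.
- rewrite ge0_integral_nu_kernel_strip//; exact: measurable_funeneg.
Qed.

End divergence.

(** * Antisymmetric functions on a reversible random walk *)

Section reversibility.
Context d (T : measurableType d) (R : realType).
Variables (nu : {measure set T -> \bar R}) (m : R.-pker T ~> T).
Hypothesis rev : reversible nu m.

Let measurable_swap_pair : measurable_fun setT (@swap_pair T T).
Proof. exact: measurable_swap. Qed.

Lemma nu_kernel_swap (C : set (T * T)) : measurable C ->
  nu_kernel nu m (swap_pair @^-1` C) = nu_kernel nu m C.
Proof.
by move=> mC; rewrite /nu_kernel [RHS]rev.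
Qed.

Lemma ae_nu_kernel_swap (P : T * T -> Prop) :
  (\forall z \ae nu_kernel nu m, P z) ->
  \forall z \ae nu_kernel nu m, P (swap_pair z).
Proof.
move=> [Z [mZ Z0 PZ]]; exists (swap_pair @^-1` Z); split.
- rewrite -[X in measurable X]setTI; exact: measurable_swap_pair.
- by rewrite -[RHS]Z0; exact: nu_kernel_swap.
- by move=> z /= nP; exact: PZ.
Qed.

Let integral_swap (D : set (T * T)) (g : T * T -> \bar R) : measurable D ->
  \int[pushforward (nu_kernel nu m) (@swap_pair T T)]_(z in D) g z =
  \int[nu_kernel nu m]_(z in D) g z.
Proof.
pose N : {measure set (T * T)%type -> \bar R} := nu_kernel nu m.
pose Nswap : {measure set (T * T)%type -> \bar R} :=
  measure_function_pushforward__canonical__measure_function_Measure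
    N measurable_swap_pair.
move=> mD; apply: (@eq_measure_integral _ _ _ D N Nswap) => C mC _.
exact: nu_kernel_swap.
Qed.

Variable f : T * T -> R.
Hypothesis intf : (nu_kernel nu m).-integrable setT (EFin \o f).
Hypothesis antif : \forall z \ae nu_kernel nu m, f (swap_pair z) = (- f z)%R.

Lemma integral_antisym_square (E : set T) : measurable E ->
  \int[nu_kernel nu m]_(z in E `*` E) (f z)%:E = 0.
Proof.
move=> mE; have mEE : measurable (E `*` E) by exact: measurableX.
have intE : (nu_kernel nu m).-integrable (E `*` E) (EFin \o f).
  exact: integrableS intf.
have mf : measurable_fun setT (EFin \o f) by exact: measurable_int intf.
have mfs : measurable_fun setT (fun z => (f (swap_pair z))%:E).
  exact: (measurableT_comp mf measurable_swap_pair).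
have mNf : measurable_fun setT (fun z => (- f z)%:E).
  under eq_fun do rewrite EFinN; exact: measurableT_comp.
have fsE : \int[nu_kernel nu m]_(z in E `*` E) (f (swap_pair z))%:E =
    - \int[nu_kernel nu m]_(z in E `*` E) (f z)%:E.
  rewrite -integralN; last exact: integrable_add_def.
  apply: ae_eq_integral => //; try exact: measurable_funTS.
  by apply: filterS antif => z fz _; rewrite fz.
have swapE : swap_pair @^-1` (E `*` E) = E `*` E.
  by apply/seteqP; split => [[x y] []|[x y] []].
have : \int[nu_kernel nu m]_(z in E `*` E) (f z)%:E =
    \int[nu_kernel nu m]_(z in E `*` E) (f (swap_pair z))%:E.
  have intfs : (nu_kernel nu m).-integrable (swap_pair @^-1` (E `*` E))
      ((EFin \o f) \o swap_pair).
    rewrite swapE; apply/integrableP; split; first exact: measurable_funTS.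
    have := @ge0_integral_pushforward _ _ _ _ _ _ measurable_swap_pair
      (nu_kernel nu m) _ (fun z => `|(f z)%:E|) mEE.
    rewrite swapE => <-//; last first.
      by apply: measurable_funTS; exact: measurableT_comp.
    apply: le_lt_trans (_ : _ <= \int[nu_kernel nu m]_(z in E `*` E) `|(f z)%:E|) _.
      by rewrite le_eqVlt; apply/orP; left; apply/eqP; exact: integral_swap.
    by case/integrableP : intE.
  have := integral_pushforward measurable_swap_pair mf intfs mEE.
  by rewrite swapE; apply: etrans; exact/esym/integral_swap.
rewrite fsE => IN.
have : \int[nu_kernel nu m]_(z in E `*` E) (f z)%:E \is a fin_num.
  exact: integrable_fin_num.
move: IN; case: (\int[_]_(z in _) _) => // r [] rN _.
by congr EFin; lra.
Qed.

(** Divergence theorem: mass exchanged inside [E] balances out, so the total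
    divergence on [E] is the flux from [E] to its complement. *)
Lemma integral_divergence_antisym (E : set T) : measurable E ->
  \int[nu]_(x in E) \int[m x]_y (f (x, y))%:E =
  \int[nu_kernel nu m]_(z in E `*` ~` E) (f z)%:E.
Proof.
move=> mE; rewrite (integral_divergence intf)//.
have -> : E `*` setT = E `*` E `|` E `*` ~` E.
  apply/seteqP; split=> [[x y] [Ex _]|[x y] [[Ex _]|[Ex _]]] //.
  by have [Ey|Ey] := pselect (E y); [left|right].
rewrite integral_setU//.
- by rewrite integral_antisym_square// add0e.
- exact: measurableX.
- by apply: measurableX => //; exact: measurableC.
- by apply: measurable_funTS; exact: measurable_int intf.
- by apply/disj_setPS => -[x y] [[_ Ey] [_]].
Qed.

End reversibility.

(** * Signs, L^q membership and constancy almost everywhere *)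

Section almost_everywhere_integrals.
Context d (T : measurableType d) (R : realType) (mu : {measure set T -> \bar R}).
Variable D : set T.
Hypothesis mD : measurable D.

Lemma ae_le_integral (f g : T -> \bar R) :
  mu.-integrable D f -> mu.-integrable D g ->
  (\forall x \ae mu, D x -> f x <= g x) ->
  \int[mu]_(x in D) f x <= \int[mu]_(x in D) g x.
Proof.
move=> intf intg [Z [mZ Z0 fgZ]].
rewrite (negligible_integral mZ mD intf Z0) (negligible_integral mZ mD intg Z0).
have mDZ : measurable (D `\` Z) by exact: measurableD.
have DZD : D `\` Z `<=` D by exact: subDsetl.
apply: le_integral => //; [exact: integrableS intf|exact: integrableS intg|].
move=> x /set_mem[Dx Zx]; apply: contrapT => nfg; apply: Zx; apply: fgZ => /=.
by move=> /(_ Dx).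
Qed.

Lemma ae_le0_integral_eq0 (f : T -> R) : mu.-integrable D (EFin \o f) ->
  (\forall x \ae mu, D x -> (f x <= 0)%R) ->
  0 <= \int[mu]_(x in D) (f x)%:E ->
  \forall x \ae mu, D x -> f x = 0%R.
Proof.
move=> intf f0 If; have mf := measurable_int _ intf.
have : \int[mu]_(x in D) `|(f x)%:E| = 0.
  apply/eqP; rewrite eq_le; apply/andP; split; last exact: integral_ge0.
  apply: (@le_trans _ _ (\int[mu]_(x in D) - (f x)%:E)).
    apply: ae_le_integral; [exact: integrable_abse|exact: integrableN|].
    by apply: filterS f0 => x fx Dx; rewrite -EFinN lee_fin ler0_norm ?fx.
  by rewrite integralN ?oppe_le0//; exact: integrable_add_def.
move/(ae_eq_integral_abs mu mD mf).
by apply: filterS => x fx Dx; have [] := fx Dx.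
Qed.

Lemma ae_le0_integral_max0 (f : T -> R) : mu.-integrable D (EFin \o f) ->
  \int[mu]_(x in D) (Num.max (f x) 0)%:E <= 0 ->
  \forall x \ae mu, D x -> (f x <= 0)%R.
Proof.
move=> intf If.
have intm : mu.-integrable D (EFin \o (fun x => Num.max (f x) 0%R)).
  apply: (eq_integrable mD (EFin \o f)^\+); last first.
    exact: integrable_funepos.
  move=> x _.
  by rewrite funeposE /= EFin_max.
have intN : mu.-integrable D (EFin \o (fun x => - Num.max (f x) 0)%R).
  exact: (integrableN intm).
have := ae_le0_integral_eq0 intN; move=> H.
have {H} : \forall x \ae mu, D x -> (- Num.max (f x) 0)%R = 0%R.
  apply: H; first by apply: aeW => x _; rewrite oppr_le0 le_max lexx orbT.
  have -> : \int[mu]_(x in D) (- Num.max (f x) 0)%:E =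
      - \int[mu]_(x in D) (Num.max (f x) 0)%:E.
    by rewrite -integralN//; exact: integrable_add_def.
  by rewrite oppe_ge0.
apply: filterS => x fx /fx /eqP; rewrite oppr_eq0 => /eqP <-.
by rewrite le_max lexx.
Qed.

(** On a set of finite measure, [L^q] is contained in [L^1], because
    [|f| <= 1 + |f| ^ q]. *)
Lemma inLp_integrable (q : R) (f : T -> R) : (1 <= q)%R -> mu D < +oo ->
  inLp mu D q f -> mu.-integrable D (EFin \o f).
Proof.
move=> q1 Doo fq.
have mf : measurable_fun setT (f \_ D).
  by move: fq; rewrite /inLp inE => /andP[/[!inE]].
have int1 : mu.-integrable D (cst 1).
  apply/integrableP; split => //.
  by under eq_integral do rewrite /= normr1; rewrite integral_cst// mul1e.
have intq : mu.-integrable D (fun x => (`|(f \_ D) x| `^ q)%:E).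
  exact: integrableS (Lfun_integrable q1 fq).
apply: le_integrable (integrableD mD int1 intq) => //.
  by apply/measurable_EFinP; exact/(measurable_restrictT _ mD).2.
move=> x Dx /=; rewrite patchE mem_set// lee_fin.
rewrite [leRHS]ger0_norm ?addr_ge0 ?powR_ge0//.
have [f1|f1] := leP `|f x|%R 1%R; first by rewrite (le_trans f1)// lerDl powR_ge0.
apply: (@le_trans _ _ (`|f x| `^ q)%R); last by rewrite lerDr.
by rewrite -[leLHS]powRr1// ler_powR// ltW.
Qed.

(** The constant is the supremum of the levels that [w] exceeds almost
    everywhere. Only countably many levels are needed to squeeze [w] around it:
    those at distance [1 / (n + 1)]. *)
Lemma ae_dichotomy_cst (w : T -> R) :
  ~ (\forall x \ae mu, ~ D x) ->
  (forall c : R, (\forall x \ae mu, D x -> (w x <= c)%R) \/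
                 (\forall x \ae mu, D x -> (c < w x)%R)) ->
  exists c : R, \forall x \ae mu, D x -> w x = c.
Proof.
move=> D0 dic.
pose S := [set c : R | \forall x \ae mu, D x -> (c < w x)%R].
(* Otherwise [w <= - n] almost everywhere for every [n]. *)
have S0 : S !=set0.
  apply: contrapT => S0; apply: (D0).
  have : \forall x \ae mu, forall n : nat, D x -> (w x <= - n%:R)%R.
    apply/ae_foralln => n; have [//|nS] := dic (- n%:R)%R.
    by exfalso; apply: S0; exists (- n%:R)%R.
  apply: filterS => x wn Dx.
  have := le_lt_trans (ler_norm (- w x)%R) (archi_boundP (normr_ge0 (- w x)%R)).
  by rewrite ltNge lerNr wn.
(* Otherwise [w >= n] almost everywhere for every [n]. *)
have supS : has_sup S.
  split => //; apply: contrapT => ubS; apply: (D0).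
  have : \forall x \ae mu, forall n : nat, D x -> (n%:R <= w x)%R.
    apply/ae_foralln => n; have [wn|] := dic n%:R.
      exfalso; apply: ubS; exists n%:R => c Sc; rewrite leNgt; apply/negP => nc.
      apply: D0; apply: filterS2 wn Sc => x wn Sc Dx.
      by have := lt_trans nc (lt_le_trans (Sc Dx) (wn Dx)); rewrite ltxx.
    by apply: filterS => x wn /wn /ltW.
  apply: filterS => x wn Dx.
  have := le_lt_trans (ler_norm (w x)) (archi_boundP (normr_ge0 (w x))).
  by rewrite ltNge wn.
exists (sup S).
have ub : \forall x \ae mu, forall n : nat, D x -> (w x <= sup S + n.+1%:R^-1)%R.
  apply/ae_foralln => n; have [//|Sn] := dic (sup S + n.+1%:R^-1)%R.
  by have := sup_upper_bound supS Sn; rewrite gerDl leNgt invr_gt0 ltr0n.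
have lb : \forall x \ae mu, forall n : nat, D x -> (sup S <= w x + n.+1%:R^-1)%R.
  apply/ae_foralln => n.
  have [//|c Sc cS] := @sup_adherent _ S n.+1%:R^-1 _ supS.
  apply: filterS Sc => x Sc Dx; rewrite -lerBlDr.
  by rewrite (le_trans (ltW cS))// ltW// Sc.
apply: filterS2 ub lb => x ub lb Dx.
by apply/eqP; rewrite eq_le; apply/andP; split; rewrite leNgt;
  apply/negP => /ltr_add_invr[n]; rewrite ltNge (ub n Dx, lb n Dx).
Qed.

End almost_everywhere_integrals.

(** * Fluxes of Leray-Lions type *)

Section flux.
Context d (T : measurableType d) (R : realType).
Variables (nu : {measure set T -> \bar R}) (m : R.-pker T ~> T).
Variables (p cp Cp : R) (a : T -> T -> R -> R) (Om : set T).
Hypotheses (rev : reversible nu m) (p1 : (1 < p)%R).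
Hypothesis ll : leray_lions nu m p cp Cp a.
Hypotheses (mOm : measurable Om) (Omoo : nu Om < +oo).
Implicit Types u w : T -> R.

Let p' : R := (p / (p - 1))%R.

Definition flux (u : T -> R) (z : T * T) : R := a z.1 z.2 (u z.2 - u z.1)%R.

(** The flux of [u] is measurable only up to a null set. It is replaced by a
    measurable function [g] that vanishes outside [Om * Om], is integrable
    because [Om] has finite measure, and inherits the antisymmetry of [a]. For
    almost every [x] the section at [x] is only changed on a null set, so the
    operator in the equation is the divergence of [g]. *)
Lemma flux_representative u :
  inLp_ae (nu_kernel nu m) (Om `*` Om) p' (flux u) ->
  exists g : T * T -> R,
  [/\ (nu_kernel nu m).-integrable setT (EFin \o g),
      forall z, ~ (Om `*` Om) z -> g z = 0%R,
      g = flux u %[ae nu_kernel nu m in Om `*` Om],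
      \forall z \ae nu_kernel nu m, g (swap_pair z) = (- g z)%R &
      \forall x \ae nu, Om x ->
        \int[m x]_(y in Om) (a x y (u y - u x)%R)%:E =
        \int[m x]_y (g (x, y))%:E].
Proof.
move=> [h hp fluxh]; exists (h \_ (Om `*` Om)).
have mOmOm : measurable (Om `*` Om) by exact: measurableX.
have OmOmoo : nu_kernel nu m (Om `*` Om) < +oo.
  rewrite nu_kernelX//; apply: le_lt_trans Omoo.
  rewrite -[leRHS]mul1e -integral_cst//; apply: ge0_le_integral => //.
  - exact: measurable_funTS (measurable_kernel m _ _).
  - move=> x _; apply: (@le_trans _ _ (m x setT)); last by rewrite prob_kernel.
    by apply: le_measure; rewrite ?inE.
have p'1 : (1 <= p')%R.
  by rewrite /p' ler_pdivlMr ?subr_gt0// mul1r gerBl.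
have E z : (Om `*` Om) z -> (h \_ (Om `*` Om)) z = h z.
  by move=> zOm; rewrite patchE mem_set.
have E0 z : ~ (Om `*` Om) z -> (h \_ (Om `*` Om)) z = 0%R.
  by move=> zOm; rewrite patchE memNset.
have Eflux : h \_ (Om `*` Om) = flux u %[ae nu_kernel nu m in Om `*` Om].
  by apply: filterS fluxh => z fz zOm; rewrite E// fz.
split => //.
- have /(integrable_mkcond _ mOmOm).1 := inLp_integrable mOmOm p'1 OmOmoo hp.
  by rewrite -restrict_EFin.
- apply: filterS3 Eflux (ae_nu_kernel_swap rev Eflux) (ll_antisym ll).
  move=> [x y] exy eyx anti.
  have [zOm|zOm] := pselect ((Om `*` Om) (x, y)); last first.
    by rewrite !E0 ?oppr0// => -[? ?]; apply: zOm.
  rewrite exy// eyx; last by case: zOm.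
  by rewrite /flux/= [in RHS]anti/= opprK opprB.
- apply: filterS (ae_nu_kernel Eflux) => x ex Omx.
  transitivity (\int[m x]_(y in Om) ((h \_ (Om `*` Om)) (x, y))%:E).
    apply: ae_eq_integral_nonmeasurable; apply: filterS ex => y exy Omy.
    by rewrite exy.
  rewrite integral_mkcond; apply: eq_integral => y _; rewrite patchE.
  by case: ifPn => // /negP yOm; rewrite E0// => -[_ /= /mem_set].
Qed.

Lemma ae_flux_lt : \forall z \ae nu_kernel nu m, forall u w,
  (u z.2 - w z.2 < u z.1 - w z.1)%R -> (flux u z < flux w z)%R.
Proof.
apply: filterS (ll_monotone ll) => z mon u w uw.
have rs : (u z.2 - u z.1 < w z.2 - w z.1)%R by lra.
have := mon _ _ (negbT (lt_eqF rs)).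
by rewrite nmulr_lgt0 ?subr_lt0.
Qed.

Lemma ae_flux_le : \forall z \ae nu_kernel nu m, forall u w,
  (u z.2 - w z.2 <= u z.1 - w z.1)%R -> (flux u z <= flux w z)%R.
Proof.
apply: filterS ae_flux_lt => z fz u w; rewrite le_eqVlt => /orP[/eqP uw|/fz/ltW//].
by rewrite /flux (_ : u z.2 - u z.1 = w z.2 - w z.1)%R//; lra.
Qed.

End flux.

(** * Comparison of a subsolution and a supersolution *)

Section comparison.
Context d (T : measurableType d) (R : realType).
Variables (nu : {measure set T -> \bar R}) (m : R.-pker T ~> T).
Variables (p cp Cp : R) (a : T -> T -> R -> R).
Variables (Om1 Om2 : set T) (gamma beta : R -> set R).
Hypotheses (rev : reversible nu m) (p1 : (1 < p)%R).
Hypothesis ll : leray_lions nu m p cp Cp a.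
Hypotheses (mOm1 : measurable Om1) (mOm2 : measurable Om2).
Hypothesis Omoo : nu (Om1 `|` Om2) < +oo.
Hypotheses (mgamma : monotone_graph gamma) (mbeta : monotone_graph beta).
Hypothesis conn : m_connected nu m (Om1 `|` Om2).
Let Om := Om1 `|` Om2.

Let mOm : measurable Om. Proof. exact: measurableU. Qed.

Let inL1 (f : T -> R) : inLp nu Om 1 f -> nu.-integrable Om (EFin \o f).
Proof. exact: inLp_integrable. Qed.

Lemma solution_sub_super phi u v :
  GP_solution nu m p a Om1 Om2 gamma beta phi u v ->
  GP_subsolution nu m p a Om1 Om2 gamma beta phi u v /\
  GP_supersolution nu m p a Om1 Om2 gamma beta phi u v.
Proof.
move=> [up vp cuv eqn].
have p'1 : (1 <= p / (p - 1))%R.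
  by rewrite ler_pdivlMr ?subr_gt0// mul1r gerBl.
have v1 : inLp nu Om 1 v.
  apply/Lfun1_integrable; rewrite -restrict_EFin.
  exact: (integrable_mkcond _ mOm).1 (inLp_integrable mOm p'1 Omoo vp).
split; split => //; apply: filterS eqn => x + Omx => /(_ Omx) -> //.
Qed.

Variables phi1 phi2 u1 v1 u2 v2 : T -> R.
Hypotheses (phi1L1 : inLp nu Om 1 phi1) (phi2L1 : inLp nu Om 1 phi2).
Hypothesis sub : GP_subsolution nu m p a Om1 Om2 gamma beta phi1 u1 v1.
Hypothesis super : GP_supersolution nu m p a Om1 Om2 gamma beta phi2 u2 v2.

Let intphi : nu.-integrable Om (EFin \o (fun x => phi1 x - phi2 x)%R).
Proof. exact: (integrableB mOm (inL1 phi1L1) (inL1 phi2L1)). Qed.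

Let intv : nu.-integrable Om (EFin \o (fun x => v1 x - v2 x)%R).
Proof.
case: sub super => _ v1L _ _ [_ v2L _ _].
exact: (integrableB mOm (inL1 v1L) (inL1 v2L)).
Qed.

Let mu12 : measurable_fun Om (fun x => u1 x - u2 x)%R.
Proof.
case: sub super => u1p _ _ _ [u2p _ _ _].
have p1' : (1 <= p)%R by exact: ltW.
apply: measurable_funB; apply/measurable_EFinP.
- exact: measurable_int (inLp_integrable mOm p1' Omoo u1p).
- exact: measurable_int (inLp_integrable mOm p1' Omoo u2p).
Qed.

(** [v1 x] and [v2 x] belong to the values at [u1 x] and [u2 x] of the same
    monotone graph, namely [gamma] or [beta]. *)
Lemma ae_graph_monotone :
  \forall x \ae nu, Om x -> (0 <= (v1 x - v2 x) * (u1 x - u2 x))%R.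
Proof.
case: sub super => _ _ [g1 b1 _] _ [_ _ [g2 b2 _] _].
apply: filterS2 (filterI g1 b1) (filterI g2 b2) => x [g1x b1x] [g2x b2x] [Omx|Omx].
- exact: mgamma (g1x Omx) (g2x Omx).
- exact: mbeta (b1x Omx) (b2x Omx).
Qed.

(** The function [h] is the difference of the two fluxes, in its measurable
    representative. The two inequalities are subtracted pointwise and integrated
    over [E]; by antisymmetry only the flux through the boundary survives. *)
Lemma sub_super_balance : exists h : T * T -> R,
  [/\ (nu_kernel nu m).-integrable setT (EFin \o h),
      forall z, ~ (Om `*` Om) z -> h z = 0%R,
      h = (fun z => flux a u1 z - flux a u2 z)%R
        %[ae nu_kernel nu m in Om `*` Om] &
      forall E, measurable E -> E `<=` Om ->
        \int[nu]_(x in E) (v1 x - v2 x)%:E <=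
        \int[nu]_(x in E) (phi1 x - phi2 x)%:E +
        \int[nu_kernel nu m]_(z in E `*` ~` E) (h z)%:E].
Proof.
case: (sub) (super) => _ _ [_ _ L1] le1 [_ _ [_ _ L2] le2].
have [g1 [int1 out1 eq1 anti1 div1]] := flux_representative rev p1 ll mOm Omoo L1.
have [g2 [int2 out2 eq2 anti2 div2]] := flux_representative rev p1 ll mOm Omoo L2.
pose h z := (g1 z - g2 z)%R.
have inth : (nu_kernel nu m).-integrable setT (EFin \o h).
  exact: (integrableB measurableT int1 int2).
exists h; split => //.
- by move=> z zOm; rewrite /h out1// out2// subrr.
- by apply: filterS2 eq1 eq2 => z e1 e2 zOm; rewrite /h e1// e2.
move=> E mE EOm.
have antih : \forall z \ae nu_kernel nu m, h (swap_pair z) = (- h z)%R.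
  by apply: filterS2 anti1 anti2 => z; rewrite /h => -> ->; rewrite opprB opprK addrC.
rewrite -(integral_divergence_antisym rev inth antih mE).
have intdiv : nu.-integrable E (fun x => \int[m x]_y (h (x, y))%:E).
  exact: integrableS (integrable_divergence inth).
have intphiE : nu.-integrable E (EFin \o (fun x => phi1 x - phi2 x)%R).
  exact: integrableS intphi.
rewrite -integralD//; apply: ae_le_integral => //.
- exact: integrableS intv.
- exact: integrableD.
apply: filterS3 (filterI le1 le2) (filterI div1 div2)
  (filterI (ae_integrable_section int1) (ae_integrable_section int2)).
move=> x [l1 l2] [d1 d2] [i1 i2] Ex.
have Omx := EOm _ Ex.
have := l1 Omx; have := l2 Omx; rewrite /GP_lhs d1// d2//.
have -> : \int[m x]_y (h (x, y))%:E =
    \int[m x]_y (g1 (x, y))%:E - \int[m x]_y (g2 (x, y))%:E.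
  by rewrite -integralB.
have := integrable_fin_num measurableT i1.
have := integrable_fin_num measurableT i2.
rewrite /comp/=.
case: (\int[m x]_y (g1 (x, y))%:E) => // r1.
case: (\int[m x]_y (g2 (x, y))%:E) => // r2 _ _.
by rewrite -!EFinB -!EFinD !lee_fin; lra.
Qed.


Let measurable_superlevel (c : R) :
  measurable (Om `&` [set x | (c < u1 x - u2 x)%R]).
Proof.
have := mu12 mOm (measurable_itv `]c, +oo[).
congr (measurable (_ `&` _)).
by apply/seteqP; split => x /=; rewrite in_itv/= andbT.
Qed.

(** On [E * (Om \ E)] the increment of [u1] is at most that of [u2], hence the
    flux difference is nonpositive there and can be dropped from the balance. *)
Lemma integral_v_le_phi E : measurable E -> E `<=` Om ->
  (forall x y, E x -> Om y -> ~ E y -> (u1 y - u2 y <= u1 x - u2 x)%R) ->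
  \int[nu]_(x in E) (v1 x - v2 x)%:E <= \int[nu]_(x in E) (phi1 x - phi2 x)%:E.
Proof.
move=> mE EOm uE; have [h [inth out heq bal]] := sub_super_balance.
have mEC : measurable (E `*` ~` E) by apply: measurableX => //; exact: measurableC.
apply: (le_trans (bal _ mE EOm)); rewrite geeDl//.
  rewrite -(integral0 (nu_kernel nu m) (E `*` ~` E)); apply: ae_le_integral => //.
  - exact: integrableS inth.
  - exact: integrable0.
  apply: filterS2 heq (ae_flux_le ll) => -[x y] hxy fle [/= Ex Ey].
  have [Omy|Omy] := pselect (Om y); last by rewrite out// => -[].
  by rewrite hxy ?lee_fin ?subr_le0; [exact: fle (uE _ _ _ _ _)|split => //; exact: EOm].
Qed.

(** Under this hypothesis the flux difference through the boundary of [E] is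
    nonnegative in total, whereas strict monotonicity makes it negative at almost
    every point of [E * (Om \ E)]: this product is null, so connectedness forces
    [E] or [Om \ E] to be null. *)
Lemma superlevel_dichotomy (c : R) :
  let E := Om `&` [set x | (c < u1 x - u2 x)%R] in
  \int[nu]_(x in E) (phi1 x - phi2 x)%:E <=
    \int[nu]_(x in E) (v1 x - v2 x)%:E ->
  (\forall x \ae nu, Om x -> (u1 x - u2 x <= c)%R) \/
  (\forall x \ae nu, Om x -> (c < u1 x - u2 x)%R).
Proof.
move=> E phiv; have [h [inth out heq bal]] := sub_super_balance.
have mE : measurable E by exact: measurable_superlevel.
have EOm : E `<=` Om by exact: subIsetl.
have mEC : measurable (E `*` ~` E) by apply: measurableX => //; exact: measurableC.
have h0 : 0 <= \int[nu_kernel nu m]_(z in E `*` ~` E) (h z)%:E.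
  have := le_trans phiv (bal _ mE EOm).
  rewrite -[X in X <= _]adde0 leeD2lE//.
  by apply: integrable_fin_num => //; exact: integrableS intphi.
have hlt : \forall z \ae nu_kernel nu m, (E `*` (Om `\` E)) z -> (h z < 0)%R.
  apply: filterS2 heq (ae_flux_lt ll) => -[x y] hxy flt [/= Ex [Omy Ey]].
  rewrite hxy ?subr_lt0; last by split => //; exact: EOm.
  apply: flt => /=; apply: (@le_lt_trans _ _ c); last by case: Ex.
  by rewrite leNgt; apply/negP => ?; exact: Ey.
have hle : \forall z \ae nu_kernel nu m, (E `*` ~` E) z -> (h z <= 0)%R.
  apply: filterS hlt => -[x y] hxy [/= Ex Ey].
  have [Omy|Omy] := pselect (Om y); last by rewrite out// => -[].
  by apply/ltW/hxy.
have heq0 := ae_le0_integral_eq0 mEC (integrableS measurableT mEC (@subsetT _ _) inth) hle h0.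
have mOmE : measurable (Om `\` E) by exact: measurableD.
have NE0 : nu_kernel nu m (E `*` (Om `\` E)) = 0.
  apply/negligibleP; first exact: measurableX.
  have : \forall z \ae nu_kernel nu m, ~ (E `*` (Om `\` E)) z.
    apply: filterS2 hlt heq0 => z hz hz0 zE.
    have := hz zE; rewrite hz0 ?ltxx//.
    by case: zE => ? [].
  by apply: negligibleS => z zE /=; exact.
have [nuE|nuE] := eqVneq (nu E) 0.
  left; have : nu.-negligible E by exact/negligibleP.
  apply: negligibleS => x /= /not_implyP[Omx /negP].
  by rewrite -ltNge.
have [nuE'|nuE'] := eqVneq (nu (Om `\` E)) 0.
  right; have : nu.-negligible (Om `\` E) by exact/negligibleP.
  by apply: negligibleS => x /= /not_implyP[Omx Ex]; split => // -[].
case: conn => _ _ /(_ E (Om `\` E) mE mOmE EOm (@subDsetl _ _ _) nuE nuE').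
by rewrite -nu_kernelX// NE0 ltxx setDUK// => /(_ erefl).
Qed.

(** On [Om] the indicator function of [E] is a selection of the sign of
    [v1 - v2] that is also compatible with the order of [u1] and [u2], so
    [v1 - v2] integrates over [E] to its positive part over [Om]. *)
Lemma L1_contraction :
  \int[nu]_(x in Om) (Num.max (v1 x - v2 x) 0)%:E <=
  \int[nu]_(x in Om) (Num.max (phi1 x - phi2 x) 0)%:E.
Proof.
pose E := Om `&` [set x | (0 < u1 x - u2 x)%R \/
  (u1 x - u2 x = 0 /\ 0 < v1 x - v2 x)%R].
have mE : measurable E.
  have m1 := measurable_superlevel 0%R.
  have m2 := mu12 mOm (measurable_set1 (0%R : R)).
  have m3 : measurable (Om `&` (fun x => v1 x - v2 x)%R @^-1` `]0%R, +oo[).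
    have /measurable_EFinP mv := measurable_int _ intv.
    exact: mv mOm _ (measurable_itv _).
  have := measurableU _ _ m1 (measurableI _ _ m2 m3); congr measurable.
  apply/seteqP; split=> x /=; rewrite in_itv/= andbT.
    by move=> [[]|[[? ?] [? ?]]]; split => //; [left|right].
  by move=> [? [?|[? ?]]]; [left|right].
have EOm : E `<=` Om by exact: subIsetl.
have -> : \int[nu]_(x in Om) (Num.max (v1 x - v2 x) 0)%:E =
    \int[nu]_(x in E) (v1 x - v2 x)%:E.
  rewrite integral_mkcond [RHS]integral_mkcond.
  apply: ae_eq_integral_nonmeasurable; apply: filterS ae_graph_monotone.
  move=> x mon _; rewrite !patchE.
  case: ifPn => [/set_mem Omx|/negP Omx]; last first.
    by rewrite memNset// => /EOm /mem_set.
  have {mon} := mon Omx; case: ifPn => [/set_mem [_ Ex] mon|/negP Ex mon].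
    congr EFin; apply/max_idPl; case: Ex => [w0|[_ /ltW//]].
    by rewrite -(pmulr_lge0 _ w0).
  congr EFin; apply/max_idPr; rewrite leNgt; apply/negP => v0; apply: Ex.
  apply/mem_set; split => //=; move: mon; rewrite pmulr_rge0// le_eqVlt.
  by move=> /orP[/eqP <-|]; [right|left].
apply: (le_trans (integral_v_le_phi mE EOm _)).
  move=> x y [_ Ex] Omy Ey; apply: (@le_trans _ _ 0%R).
    by rewrite leNgt; apply/negP => w0; apply: Ey; split => //; left.
  by case: Ex => [/ltW//|[-> //]].
have intm : nu.-integrable Om (EFin \o (fun x => Num.max (phi1 x - phi2 x) 0)%R).
  apply: (eq_integrable mOm (EFin \o (fun x => phi1 x - phi2 x)%R)^\+); last first.
    exact: integrable_funepos.
  by move=> x _; rewrite funeposE /= EFin_max.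
apply: (@le_trans _ _ (\int[nu]_(x in E) (Num.max (phi1 x - phi2 x) 0)%:E)).
  apply: le_integral => //; [exact: integrableS intphi|exact: integrableS intm|].
  by move=> x _; rewrite lee_fin le_max lexx.
apply: ge0_subset_integral => //; first exact: measurable_int intm.
by move=> x _; rewrite lee_fin le_max lexx orbT.
Qed.

Hypothesis phi12 : \forall x \ae nu, Om x -> (phi1 x <= phi2 x)%R.

Lemma sub_le_super_v : \forall x \ae nu, Om x -> (v1 x <= v2 x)%R.
Proof.
have : \int[nu]_(x in Om) (Num.max (v1 x - v2 x) 0)%:E <= 0.
  apply: (le_trans L1_contraction).
  rewrite [X in X <= _](_ : _ = \int[nu]_(x in Om) cst 0 x).
    by rewrite integral0.
  apply: ae_eq_integral_nonmeasurable; apply: filterS phi12 => x phi12x Omx.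
  by congr EFin; apply/max_idPr; rewrite subr_le0 phi12x.
move/(ae_le0_integral_max0 mOm intv); apply: filterS => x vx /vx.
by rewrite subr_le0.
Qed.

Hypothesis phi12_neq : ~ (phi1 = phi2 %[ae nu in Om]).

(** Taking [E = Om] in the balance, there is no boundary: equality of [v1] and
    [v2] would give [0 <= \int_Om (phi1 - phi2)], hence [phi1 = phi2]. *)
Lemma sub_neq_super_v : ~ (v1 = v2 %[ae nu in Om]).
Proof.
move=> v12; apply: phi12_neq.
have := ae_le0_integral_eq0 mOm intphi; move=> phi0.
have {phi0} : \forall x \ae nu, Om x -> (phi1 x - phi2 x = 0)%R.
  apply: phi0.
    by apply: filterS phi12 => x phi12x /phi12x; rewrite subr_le0.
  rewrite [X in X <= _](_ : _ = \int[nu]_(x in Om) (v1 x - v2 x)%:E).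
    exact: integral_v_le_phi.
  rewrite -[LHS](integral0 nu Om).
  apply: ae_eq_integral_nonmeasurable; apply: filterS v12 => x v12x Omx.
  by rewrite v12x// subrr.
by apply: filterS => x phi0 /phi0 /eqP; rewrite subr_eq0 => /eqP.
Qed.

(** Where [u1 > u2], the two opposite inequalities between [v1] and [v2] give
    [v1 = v2]. So the superlevel set of [u1 - u2] at [0] satisfies the hypothesis
    of the dichotomy, and it cannot have full measure since [v1 <> v2]. *)
Lemma sub_le_super_u : \forall x \ae nu, Om x -> (u1 x <= u2 x)%R.
Proof.
have v12 : \forall x \ae nu, Om x -> (0 < u1 x - u2 x)%R -> v1 x = v2 x.
  apply: filterS2 sub_le_super_v ae_graph_monotone => x vx mon Omx w0.
  apply/eqP; rewrite eq_le vx//= -subr_ge0.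
  by rewrite -(pmulr_lge0 _ w0) mon.
have [||] := @superlevel_dichotomy 0%R.
- set E := Om `&` _.
  have mE : measurable E by exact: measurable_superlevel.
  have EOm : E `<=` Om by exact: subIsetl.
  rewrite [X in _ <= X](_ : _ = \int[nu]_(x in E) cst 0 x); last first.
    apply: ae_eq_integral_nonmeasurable; apply: filterS v12 => x v12x [Omx Ex].
    by rewrite v12x// subrr.
  apply: ae_le_integral => //.
  - exact: integrableS intphi.
  - exact: integrable0.
  by apply: filterS phi12 => x phi12x /EOm /phi12x; rewrite lee_fin subr_le0.
- by apply: filterS => x ux /ux; rewrite subr_le0.
- move=> w0; exfalso; apply: sub_neq_super_v.
  by apply: filterS2 v12 w0 => x v12x w0 Omx; apply: v12x => //; exact: w0.
Qed.

End comparison.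

(** * The comparison theorem *)

Theorem theorem2p6 (R : realType) (X : completeMetricType R)
    (m : R.-pker borel X ~> borel X)
    (nu : {sigma_finite_measure set (borel X) -> \bar R})
    (p cp Cp : R) (a : borel X -> borel X -> R -> R)
    (Om1 Om2 : set (borel X)) (gamma beta : R -> set R) :
  separable X ->
  finite_first_moments m ->
  reversible nu m ->
  (1 < p)%R -> (0 < cp)%R -> (0 < Cp)%R ->
  leray_lions nu m p cp Cp a ->
  measurable Om1 -> measurable Om2 -> Om1 `&` Om2 = set0 ->
  nu Om1 != 0 -> nu Om2 != 0 ->
  m_connected nu m (Om1 `|` Om2) ->
  nu (Om1 `|` Om2) < +oo ->
  nu.-negligible [set x | (Om1 `|` Om2) x /\
                          singular_on (Om1 `|` Om2) (m x) nu] ->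
  maximal_monotone gamma -> maximal_monotone beta ->
  gamma 0%R 0%R -> beta 0%R 0%R ->
  Rminus nu Om1 Om2 gamma beta < Rplus nu Om1 Om2 gamma beta ->
  poincare nu m p (Om1 `|` Om2) ->
  forall phi1 phi2 u1 v1 u2 v2 : borel X -> R,
  inLp nu (Om1 `|` Om2) 1 phi1 ->
  inLp nu (Om1 `|` Om2) 1 phi2 ->
  [/\ GP_subsolution nu m p a Om1 Om2 gamma beta phi1 u1 v1 ->
      GP_supersolution nu m p a Om1 Om2 gamma beta phi2 u2 v2 ->
      \int[nu]_(x in Om1 `|` Om2) (Num.max (v1 x - v2 x) 0)%:E <=
      \int[nu]_(x in Om1 `|` Om2) (Num.max (phi1 x - phi2 x) 0)%:E,
      GP_subsolution nu m p a Om1 Om2 gamma beta phi1 u1 v1 ->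
      GP_supersolution nu m p a Om1 Om2 gamma beta phi2 u2 v2 ->
      (\forall x \ae nu, (Om1 `|` Om2) x -> (phi1 x <= phi2 x)%R) ->
      ~ (phi1 = phi2 %[ae nu in Om1 `|` Om2]) ->
      [/\ \forall x \ae nu, (Om1 `|` Om2) x -> (v1 x <= v2 x)%R,
          ~ (v1 = v2 %[ae nu in Om1 `|` Om2]) &
          \forall x \ae nu, (Om1 `|` Om2) x -> (u1 x <= u2 x)%R] &
      GP_solution nu m p a Om1 Om2 gamma beta phi1 u1 v1 ->
      GP_solution nu m p a Om1 Om2 gamma beta phi2 u2 v2 ->
      phi1 = phi2 %[ae nu in Om1 `|` Om2] ->
      v1 = v2 %[ae nu in Om1 `|` Om2] /\
      exists c : R,
        \forall x \ae nu, (Om1 `|` Om2) x -> (u1 x - u2 x)%R = c].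
Proof.
move=> _ _ rev p1 _ _ ll mOm1 mOm2 _ _ _ conn Omoo _ [mgamma _] [mbeta _] _ _ _ _.
move=> phi1 phi2 u1 v1 u2 v2 phi1L phi2L.
have solSS := @solution_sub_super _ _ _ nu m p a Om1 Om2 gamma beta p1
  mOm1 mOm2 Omoo.
split.
- move=> sub super.
  exact: (L1_contraction rev p1 ll mOm1 mOm2 Omoo mgamma mbeta
    phi1L phi2L sub super).
- move=> sub super phi12 phi12N; split.
  + exact: (sub_le_super_v rev p1 ll mOm1 mOm2 Omoo mgamma mbeta
      phi1L phi2L sub super phi12).
  + exact: (sub_neq_super_v rev p1 ll mOm1 mOm2 Omoo
      phi1L phi2L sub super phi12 phi12N).
  + exact: (sub_le_super_u rev p1 ll mOm1 mOm2 Omoo mgamma mbeta conn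
      phi1L phi2L sub super phi12 phi12N).
move=> sol1 sol2 phi12.
have [sub1 super1] := solSS _ _ _ sol1.
have [sub2 super2] := solSS _ _ _ sol2.
have v12 : v1 = v2 %[ae nu in Om1 `|` Om2].
  have le12 : \forall x \ae nu, (Om1 `|` Om2) x -> (v1 x <= v2 x)%R.
    apply: (sub_le_super_v rev p1 ll mOm1 mOm2 Omoo mgamma mbeta
      phi1L phi2L sub1 super2).
    by apply: filterS phi12 => x + Omx => ->.
  have le21 : \forall x \ae nu, (Om1 `|` Om2) x -> (v2 x <= v1 x)%R.
    apply: (sub_le_super_v rev p1 ll mOm1 mOm2 Omoo mgamma mbeta
      phi2L phi1L sub2 super1).
    by apply: filterS phi12 => x + Omx => ->.
  apply: filterS2 le12 le21 => x vx12 vx21 Omx.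
  by apply/eqP; rewrite eq_le vx12 ?vx21.
(* With equal data and equal [v], both sides of the hypothesis of the dichotomy
   vanish at every level. *)
split => //; apply: ae_dichotomy_cst.
  move=> Om0; case: conn => mOm + _; rewrite lt0e => /andP[/eqP + _]; apply.
  apply/negligibleP => //; apply: negligibleS Om0 => x Omx /=; exact.
move=> c; apply: (superlevel_dichotomy rev p1 ll mOm1 mOm2 Omoo conn
  phi1L phi2L sub1 super2).
rewrite le_eqVlt; apply/orP; left; apply/eqP.
apply: ae_eq_integral_nonmeasurable.
by apply: filterS2 phi12 v12 => x p12 vx12 [Omx _]; rewrite p12// vx12// !subrr.
Qed.
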